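(* Let $p$ be a prime, let $s,r\ge1$ be integers, $q=p^r$, $L=GR(p^s,r)$, and let $m$ be a positive integer such that $rm\ge s$. Then, for $0\le\nu\le m(q-1)$, the generalized Reed-Muller code $RM_L(\nu,m)$ is a free $L$-module of rank $$k=\sum_{i=0}^{\nu}\sum_{j=0}^{m}(-1)^j\binom{m}{j}\binom{i-jq+m-1}{i-jq}.$$
   Context: Convention: $\binom{a}{b}=0$ when $b<0$. $L=GR(p^s,r)$ is the Galois ring of characteristic $p^s$ with $p^{sr}$ elements; it is local with maximal ideal $pL$ and residue field $\mathbb{F}_q$. Put $n=q^m-1$. Let $h(x)\in L[x]$ be a monic basic primitive polynomial of degree $m$ (i.e. its reduction mod $p$ is a primitive polynomial over $\mathbb{F}_q$) dividing $x^{n}-1$, with a root $\xi$ of multiplicative order $n$ in $\mathcal{R}=L[x]/(h(x))=GR(p^s,rm)$. Then $\{1,\xi,\dots,\xi^{m-1}\}$ is an $L$-basis of $\mathcal{R}$. For $0\le i\le n-1$ write uniquely $\xi^i=b_{1i}+b_{2i}\xi+\dots+b_{mi}\xi^{m-1}$ with $b_{ji}\in L$, and set $b_i=(b_{1i},\dots,b_{mi})\in L^m$, $b_\infty=(0,\dots,0)$. For $P\in L[x_1,\dots,x_m]$ let $ev(P)=(P(b_\infty),P(b_0),P(b_1),\dots,P(b_{n-1}))\in L^{q^m}$. The generalized Reed-Muller code of order $\nu$ over $L$ is $$RM_L(\nu,m)=\{ev(P)\mid P\in L[x_1,\dots,x_m],\ \deg_{x_i}P\le q-1\ (1\le i\le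 m),\ \deg P\le\nu\},$$ where $\deg$ is the total degree and $\deg 0=-\infty$. *)

(* Defs.v *)
From HB Require Import structures.
From mathcomp Require Import all_boot all_order all_algebra all_field.
From mathcomp Require Import ring_quotient qpoly qfpoly mpoly.

Set Implicit Arguments.
Unset Strict Implicit.
Unset Printing Implicit Defensive.

Import GRing.Theory.
Local Open Scope ring_scope.

Definition princ_ideal (R : finComNzRingType) (a : R) : {set R} :=
  [set a * x | x : R].

(* [idealr_closed] characterizes proper ideals, so the last clause says that
   pL is the unique maximal ideal of L. *)
Definition galois_ring (p s r : nat) (L : finComNzRingType) : Prop :=
  [/\ (p ^ s)%:R = 0 :> L /\ (forall k, (0 < k < p ^ s)%N -> k%:R != 0 :> L),
      #|L| = (p ^ (s * r))%N,
      idealr_closed (princ_ideal (p%:R : L)) &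
      forall I : {set L}, idealr_closed I -> I \subset princ_ideal (p%:R : L)].

(* [red] presents F as the residue field L / pL. *)
Definition residue_map (p : nat) (L : finComNzRingType) (F : finFieldType)
    (red : {rmorphism L -> F}) : Prop :=
  (forall y : F, exists x : L, red x = y) /\
  (forall x : L, (red x == 0) = (x \in princ_ideal (p%:R : L))).

(* [primitive_poly f]: f is monic irreducible of order |F|^(deg f) - 1, this
   number being written #|{poly %/ f}|.-1. *)
Definition basic_primitive (L : finComNzRingType) (F : finFieldType)
    (red : {rmorphism L -> F}) (m : nat) (h : {poly L}) : Prop :=
  [/\ h \is monic, size h = m.+1 & primitive_poly (map_poly red h)].

Section ReedMuller.
Variables (L : comNzRingType) (q m : nat).

(* The evaluation points b_oo = 0, b_0, b_1, ..., shifted by one. *)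
Definition eval_point (b : nat -> 'rV[L]_m) (k : nat) : 'rV[L]_m :=
  if k is i.+1 then b i else 0.

Definition ev (b : nat -> 'rV[L]_m) (P : {mpoly L[m]}) : 'rV[L]_(q ^ m) :=
  \row_(k < q ^ m) P.@[eval_point b k 0].

(* [msize P] is 1 + the total degree of P, and 0 for P = 0. *)
Definition RM (b : nat -> 'rV[L]_m) (nu : nat) (c : 'rV[L]_(q ^ m)) : Prop :=
  exists P : {mpoly L[m]},
    [/\ forall (i : 'I_m) (mu : 'X_{1..m}), mu \in msupp P -> (mu i <= q.-1)%N,
        (msize P <= nu.+1)%N & c = ev b P].

End ReedMuller.

(* C is the R-submodule of V with basis e. *)
Definition is_basis (R : nzRingType) (V : lmodType R) (C : V -> Prop) (k : nat)
    (e : 'I_k -> V) : Prop :=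
  (forall v : V, C v <-> exists a : 'I_k -> R, v = \sum_(i < k) a i *: e i) /\
  (forall a : 'I_k -> R, \sum_(i < k) a i *: e i = 0 -> forall i, a i = 0).

Definition free_of_rank (R : nzRingType) (V : lmodType R) (C : V -> Prop)
    (k : nat) : Prop :=
  exists e : 'I_k -> V, is_basis C e.

(* The binomial coefficient on integers, 0 for a negative lower argument; for
   a negative upper argument, binom(-(k+1), l) = (-1)^l binom(k+l, l). *)
Definition binz (a b : int) : int :=
  match b, a with
  | Negz _, _ => 0
  | Posz l, Posz k => 'C(k, l)%:Z
  | Posz l, Negz k => (-1) ^+ l * 'C(k + l, l)%:Z
  end.

Definition RM_rank (q m nu : nat) : int :=
  \sum_(0 <= i < nu.+1) \sum_(0 <= j < m.+1)
    (-1) ^+ j * binz m%:Z j%:Z *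
    binz (i%:Z - j%:Z * q%:Z + m%:Z - 1) (i%:Z - j%:Z * q%:Z).

(* Main.v *)
(** The coordinate vectors of 0 and of the powers of [xi] reduce mod p to
    pairwise distinct vectors: a coincidence would bound the order of a root of
    the primitive polynomial [map_poly red h].  Since |F| = q, they reduce onto
    F^m.  Over F the evaluation matrix of the reduced monomials at all points
    of F^m is a tensor power of a Vandermonde matrix, hence has a left inverse;
    a lift of it is a left inverse modulo p, and p is nilpotent, so the
    evaluated monomials are linearly independent over L.  The rank is then the
    number of reduced monomials of degree at most [nu], read off the generating
    polynomial (1 + X + ... + X^(q-1))^m = (1 - X^q)^m / (1 - X)^m. *)

Require Import Defs.
From HB Require Import structures.
From mathcomp Require Import all_boot all_order all_algebra all_field.
From mathcomp Require Import ring_quotient qpoly qfpoly mpoly.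

Set Implicit Arguments.
Unset Strict Implicit.
Unset Printing Implicit Defensive.

Import GRing.Theory.
Local Open Scope ring_scope.

(** * Counting reduced monomials with generating polynomials *)

Lemma eq_coefMr (R : nzRingType) (p u v : {poly R}) i :
  (forall j, (j <= i)%N -> u`_j = v`_j) -> (p * u)`_i = (p * v)`_i.
Proof.
by move=> uv; rewrite !coefM; apply: eq_bigr => j _; rewrite uv ?leq_subr.
Qed.

(** The second factor truncates the power series of (1 - X)^(-m). By Pascal's rule, multiplying by 1
    - X lowers [m] by one; the predecessor makes [m = 0] give the constant 1. *)
Lemma coef_inv_oneBX (m N i : nat) : (i < N)%N ->
  ((1 - 'X) ^+ m * \poly_(k < N) 'C((k + m).-1, k)%:R : {poly int})`_i
    = (i == 0%N)%:R.
Proof.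
elim: m i => [|m IHm] i iN.
  rewrite expr0 mul1r coef_poly iN addn0.
  by case: i iN => [|i] _ //=; rewrite bin_small.
rewrite exprSr -mulrA -IHm //; apply: eq_coefMr => -[|j] ji.
  rewrite mulrBl mul1r coefB coefXM !coef_poly.
  by rewrite (leq_ltn_trans ji iN) !bin0 subr0.
have jN := leq_ltn_trans ji iN.
rewrite mulrBl mul1r coefB coefXM !coef_poly jN (ltnW jN) /=.
by rewrite addnS /= binS natrD addrK.
Qed.

Lemma coef_geometric_pow (q m i : nat) :
  ((\sum_(j < q) 'X^j) ^+ m : {poly int})`_i =
  \sum_(j < m.+1) (-1) ^+ j * 'C(m, j)%:R *
    (if (i < j * q)%N then 0 else 'C((i - j * q + m).-1, i - j * q)%:R).
Proof.
set G := _ ^+ m.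
have GE : G * (1 - 'X) ^+ m = (1 - 'X^q) ^+ m.
  by rewrite -exprMn -[1 - 'X^q]opprB subrX1 -mulNr opprB mulrC.
pose E : {poly int} := \poly_(k < i.+1) 'C((k + m).-1, k)%:R.
(* The coefficient at [i] involves only degrees up to [i], where (1 - X)^m * [E] agrees with 1. *)
have -> : G`_i = ((1 - 'X^q) ^+ m * E)`_i.
  rewrite -GE -mulrA -{1}[G]mulr1; apply: eq_coefMr => j ji.
  by rewrite coef1 coef_inv_oneBX.
rewrite exprBn_comm; last exact: commr_sym (commr1 _).
rewrite mulr_suml coef_sum; apply: eq_bigr => j _.
rewrite expr1n mulr1 -exprM mulrnAl coefMn -mulrA.
have -> : (-1) ^+ j = ((-1) ^+ j)%:P :> {poly int}.
  by rewrite rmorphXn rmorphN rmorph1.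
rewrite coefCM coefXnM mulnC -mulrnAr -mulrA; congr (_ * _).
case: ltnP => ij; first by rewrite mul0rn mulr0.
by rewrite coef_poly ltnS leq_subr mulr_natl.
Qed.

(** Expanding the power by distributivity yields one term X^(sum of f) per function f. *)
Lemma card_ffun_sum (q m i : nat) :
  #|[set f : {ffun 'I_m -> 'I_q} | (\sum_j f j == i)%N]|%:R =
  ((\sum_(j < q) 'X^j) ^+ m : {poly int})`_i.
Proof.
rewrite -[X in _ ^+ X]card_ord -prodr_const bigA_distr_bigA /= coef_sum.
rewrite -sum1_card natr_sum big_mkcond; apply: eq_bigr => f _.
by rewrite inE prodrXr coefXn eq_sym; case: eqP.
Qed.

Lemma RM_rankE (q m nu : nat) : (0 < m)%N ->
  #|[set f : {ffun 'I_m -> 'I_q} | (\sum_j f j <= nu)%N]|%:Z = RM_rank q m nu.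
Proof.
move=> m0; rewrite /RM_rank.
have -> : #|[set f : {ffun 'I_m -> 'I_q} | (\sum_j f j <= nu)%N]| =
   (\sum_(i < nu.+1) #|[set f : {ffun 'I_m -> 'I_q} | \sum_j f j == i]|)%N.
  rewrite -sum1_card (partition_big
    (fun f : {ffun 'I_m -> 'I_q} => inord (\sum_j f j) : 'I_nu.+1) xpredT) //=.
  apply: eq_bigr => i _; rewrite -sum1_card; apply: eq_bigl => f.
  rewrite !inE; apply/andP/eqP => [[fle /eqP <-]|->]; first by rewrite inordK.
  by rewrite -ltnS ltn_ord inord_val eqxx.
rewrite big_mkord -[LHS]mulr1n -natz natr_sum; apply: eq_bigr => i _.
rewrite card_ffun_sum coef_geometric_pow big_mkord; apply: eq_bigr => j _.
rewrite /= natz -!mulrA; congr (_ * (_ * _)).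
(* A negative lower argument makes [binz] vanish; otherwise [0 < m] keeps the upper argument
   nonnegative, so both are ordinary binomials. *)
case: ltnP => ij.
  have : i%:Z - j%:Z * q%:Z < 0
    by rewrite Num.Theory.subr_lt0 -PoszM ltz_nat.
  by case: (i%:Z - j%:Z * q%:Z).
rewrite -PoszM subzn // -PoszD subzn ?subn1 ?natz //.
by rewrite (leq_trans m0) ?leq_addl.
Qed.

(** * Distinctness of the evaluation points modulo p *)

Lemma comp_polyXn (R : comNzRingType) (p : {poly R}) n : 'X^n \Po p = p ^+ n.
Proof. by rewrite rmorphXn /= comp_polyX. Qed.

Lemma dvdp_red_in_qpoly0 (L : comNzRingType) (F : fieldType)
    (red : {rmorphism L -> F}) (h P : {poly L}) :
  h \is monic -> (1 < size h)%N -> in_qpoly h P = 0 ->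
  map_poly red h %| map_poly red P.
Proof.
move=> hM sh /(congr1 val) /=; rewrite /mk_monic sh hM /= => P0.
by rewrite (Pdiv.RingMonic.rdivp_eq hM P) P0 addr0 rmorphM /= dvdp_mull.
Qed.

Lemma primitive_dvdp_XnB1 (F : finFieldType) (f : {poly F}) d :
  primitive_poly f -> (0 < d)%N -> f %| 'X^d - 1 ->
  (#|F| ^ (size f).-1 <= d.+1)%N.
Proof.
move=> fP d0 fd; have /primitive_polyP[_ _ fmin] := fP.
rewrite -(card_primitive_qpoly fP) leqNgt; apply/negP => dv.
by have := fmin d; rewrite fd d0 ltn_predRL dv => /(_ isT).
Qed.

(* A root g of f modulo f is conjugate to 'X, so it has the same order. *)
Lemma primitive_dvdp_rootXnB1 (F : finFieldType) (f g : {poly F}) d :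
  primitive_poly f -> (0 < d)%N -> f %| f \Po g -> f %| g ^+ d - 1 ->
  (#|F| ^ (size f).-1 <= d.+1)%N.
Proof.
move=> fP d0 fg gd; apply: primitive_dvdp_XnB1 => //.
have /primitive_polyP[[f_irr fM] _ _] := fP.
(* Otherwise a Bezout relation between f and X^d - 1, evaluated at g, would make f divide 1. *)
apply: contraT; rewrite -irreducible_poly_coprime //.
case/Bezout_eq1_coprimepP => -[u v] /= /(congr1 (comp_poly g)) uv1.
suff : f %| 1 by rewrite dvdp1; case: f_irr => + _; case: size => [|[]].
move: uv1; rewrite comp_polyD !comp_polyM comp_polyB comp_polyXn.
rewrite -polyC1 !comp_polyC polyC1 => <-.
by rewrite dvdp_add ?dvdp_mull.
Qed.

(** Since [xi] need not be the class of X, its relations are carried to F[x] through its reduced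
    representative [g]. The first conclusion later helps to identify |F|, and injectivity is then
    available. *)
Lemma root_qpoly_powers_inj (L : finComNzRingType) (F : finFieldType)
    (red : {rmorphism L -> F}) (m n : nat) (h : {poly L}) (xi : {poly %/ h})
    (b : nat -> 'rV[L]_m) :
  (0 < m)%N -> (0 < n)%N -> basic_primitive red m h ->
  root (map_poly (in_alg {poly %/ h}) h) xi -> xi ^+ n = 1 ->
  (forall i : nat, (i < n)%N ->
     xi ^+ i = \sum_(j < m) b i 0 j *: xi ^+ j) ->
  (#|F| ^ m <= n.+1)%N /\
  ((n < #|F| ^ m)%N ->
    {in gtn n.+1 &, injective (fun k => map_mx red (eval_point b k))}).
Proof.
move=> m0 n0 [hM sh fP] hxi xin bE.
have h1 : (1 < size h)%N by rewrite sh.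
set f := map_poly red h in fP; pose g := map_poly red xi.
have sf : size f = m.+1.
  by rewrite size_map_poly_id0 // (monicP hM) rmorph1 oner_neq0.
have xiE Q : (map_poly (in_alg {poly %/ h}) Q).[xi] = 0 ->
    f %| map_poly red Q \Po g.
  move=> Q0; rewrite -map_comp_poly; apply: dvdp_red_in_qpoly0 => //.
  rewrite in_qpoly_comp_horner.
  have -> : in_qpoly h xi = xi by apply/val_inj/in_qpoly_small/size_mk_monic.
  rewrite -[RHS]Q0; congr (_.[_]); apply: eq_map_poly => c.
  by apply: val_inj; rewrite /= alg_polyC.
have fg : f %| f \Po g by apply: xiE; apply/eqP.
have gn : f %| g ^+ n - 1.
  have := xiE ('X^n - 1).
  rewrite !rmorphB !rmorph1 /= !map_polyXn hornerD hornerN hornerXn hornerC xin.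
  by rewrite comp_polyXn subrr; apply.
have gi i : (i < n)%N -> f %| g ^+ i - \sum_(j < m) red (b i 0 j) *: g ^+ j.
  move=> /bE iE; have := xiE ('X^i - \sum_(j < m) b i 0 j *: 'X^j).
  rewrite !rmorphB !rmorph_sum /= !map_polyXn hornerD hornerN.
  rewrite hornerXn horner_sum.
  rewrite {1}iE comp_polyXn.
  set u := (X in X - _ = 0); set v := (X in _ - X = 0).
  have -> : u = v.
    by apply: eq_bigr => j _; rewrite map_polyZ map_polyXn hornerZ
      hornerXn mulr_algl.
  rewrite subrr => /(_ erefl); congr (_ %| _ - _); apply: eq_bigr => j _.
  by rewrite map_polyZ map_polyXn /= comp_polyZ comp_polyXn.
have f1 : ~~ (f %| 1) by rewrite dvdp1 sf; case: (m) m0.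
have /primitive_polyP[[f_irr _] _ _] := fP.
(* Since [g ^+ n] is 1 modulo [f], [g] is invertible there and its powers can be cancelled. *)
have cfg : coprimep f g.
  rewrite irreducible_poly_coprime //; apply: contra f1 => fdg.
  have -> : 1 = g ^+ n - (g ^+ n - 1) by rewrite opprB addrC subrK.
  by rewrite dvdp_sub // (dvdp_trans fdg) // -{1}[g]expr1 dvdp_exp2l.
have cfgi i : coprimep f (g ^+ i) by rewrite coprimep_expr.
have fNg i : ~~ (f %| g ^+ i).
  by apply: contra f1; rewrite -{1}[g ^+ i]mulr1 Gauss_dvdpr.
have ord d : (0 < d)%N -> f %| g ^+ d - 1 -> (#|F| ^ m <= d.+1)%N.
  by move=> d0 gd; have := primitive_dvdp_rootXnB1 fP d0 fg gd; rewrite sf.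
split=> [|nF]; first exact: ord.
have ne i k : (i < k < n)%N -> map_mx red (b i) != map_mx red (b k).
  case/andP=> ik kn; apply/eqP => bik.
  have : f %| g ^+ k - g ^+ i.
    have := dvdp_sub (gi _ kn) (gi _ (ltn_trans ik kn)).
    rewrite (eq_bigr (fun j => red (b i 0 j) *: g ^+ j)).
      by rewrite opprB addrA subrK.
    by move=> j _; move/rowP/(_ j): bik; rewrite !mxE => ->.
  (* Cancelling [g ^+ i] leaves [g] of order dividing k - i, so n < |F|^m <= k - i + 1, against k <
     n. *)
  rewrite -(subnKC (ltnW ik)) exprD -{2}[g ^+ i]mulr1 -mulrBr Gauss_dvdpr //.
  move/ord; rewrite subn_gt0 => /(_ ik).
  move/(leq_trans nF); rewrite ltnS leqNgt.
  by rewrite (leq_ltn_trans (leq_subr _ _) kn).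
(* A zero coordinate vector would make [f] divide [g ^+ i]. *)
have ne0 i : (i < n)%N -> map_mx red (b i) != 0.
  move=> /gi; apply: contraTneq => bi0; rewrite big1 ?subr0 // => j _.
  by move/rowP/(_ j): bi0; rewrite !mxE => ->; rewrite scale0r.
move=> [|i] [|k] //; rewrite !inE /= !ltnS => iN kN /eqP.
- by rewrite map_mx0 eq_sym (negPf (ne0 _ _)).
- by rewrite map_mx0 (negPf (ne0 _ _)).
case: (ltngtP i k) => [ik|ki|-> //] E.
  by rewrite (negPf (ne _ _ _)) ?ik in E.
by rewrite eq_sym (negPf (ne _ _ _)) ?ki in E.
Qed.

(** * Lifting from the residue field *)

Section Residue.
Variables (p s : nat) (L : finComNzRingType) (F : finFieldType).
Variable red : {rmorphism L -> F}.
Hypotheses (redP : residue_map p red) (ps0 : (p ^ s)%:R = 0 :> L).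

Lemma residue_section : exists t : F -> L, cancel t red.
Proof. by have [/fin_all_exists[t tK] _] := redP; exists t. Qed.

Lemma residue_ker x : red x = 0 -> exists y, x = p%:R * y.
Proof.
have [_ kerE] := redP => /eqP; rewrite kerE => /imsetP[y _ ->].
by exists y.
Qed.

(** Elements of L have p-adic expansions with [s] digits in the image of a section of [red]; the
    remainder is killed by p^s = 0. *)
Lemma card_residue_le : (#|L| <= #|F| ^ s)%N.
Proof.
have [t tK] := residue_section.
have expand k x : exists f : {ffun 'I_k -> F}, exists y,
    x = \sum_(i < k) (p ^ i)%:R * t (f i) + (p ^ k)%:R * y.
  elim: k => [|k [f [y ->]]].
    by exists [ffun=> 0], x; rewrite big_ord0 add0r mul1r.
  have [z yz] : exists z, y - t (red y) = p%:R * z.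
    by apply: residue_ker; rewrite rmorphB tK subrr.
  (* The new digit [red y] goes last; subtracting its lift from [y] leaves a multiple of p. *)
  exists [ffun i => if unlift ord_max i is Some j then f j else red y], z.
  rewrite big_ord_recr /= ffunE unlift_none -addrA; congr (_ + _).
    apply: eq_bigr => i _; rewrite ffunE.
    have -> : widen_ord (leqnSn k) i = lift ord_max i.
      by apply: val_inj; rewrite /= /bump leqNgt ltn_ord.
    by rewrite liftK.
  by rewrite expnSr natrM -mulrA -yz -mulrDr addrC subrK.
pose g (f : {ffun 'I_s -> F}) : L := \sum_(i < s) (p ^ i)%:R * t (f i).
have g_onto x : x \in codom g.
  by have [f [y ->]] := expand s x; rewrite ps0 mul0r addr0; apply: codom_f.
have -> : #|L| = #|codom g| by apply: eq_card => x; rewrite g_onto.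
by rewrite (leq_trans (leq_image_card _ _)) // card_ffun card_ord.
Qed.

(** A lift T of [W] satisfies T M = 1 + p Z, so M a = 0 gives a = - p Z a. Iterating puts a in p^s L
    = 0. *)
Lemma residue_lift_free (I J : finType) (M : J -> I -> L) (W : I -> J -> F)
    (a : I -> L) :
  (forall i i', \sum_j W i j * red (M j i') = (i == i')%:R) ->
  (forall j, \sum_i a i * M j i = 0) -> forall i, a i = 0.
Proof.
have [t tK] := residue_section => WM aM.
have /fin_all_exists[z zE] (ii : I * I) : exists y : L,
    \sum_j t (W ii.1 j) * M j ii.2 = (ii.1 == ii.2)%:R + p%:R * y.
  have [|y yE] := @residue_ker
    (\sum_j t (W ii.1 j) * M j ii.2 - (ii.1 == ii.2)%:R).
    rewrite rmorphB rmorph_sum rmorph_nat -WM.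
    by under eq_bigr do rewrite rmorphM tK; rewrite subrr.
  by exists y; rewrite -yE addrC subrK.
have aE i : a i = p%:R * - (\sum_i' a i' * z (i, i')).
  apply/eqP; rewrite mulrN -addr_eq0 mulr_sumr; apply/eqP.
  transitivity (\sum_j t (W i j) * (\sum_i' a i' * M j i')); last first.
    by rewrite big1 // => j _; rewrite aM mulr0.
  under [RHS]eq_bigr do rewrite mulr_sumr.
  rewrite exchange_big /=.
  have -> : a i = \sum_i' a i' * (i == i')%:R.
    rewrite (bigD1 i) //= eqxx mulr1 big1 ?addr0 // => i' ii'.
    by rewrite eq_sym (negPf ii') mulr0.
  rewrite -big_split; apply: eq_bigr => i' _ /=.
  under [RHS]eq_bigr do rewrite mulrCA.
  by rewrite -mulr_sumr (zE (i, i')) mulrDr [in RHS]mulrCA.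
have a_div k i : exists c, a i = (p ^ k)%:R * c.
  elim: k i => [|k IHk] i; first by exists (a i); rewrite mul1r.
  have [c cE] := fin_all_exists IHk.
  exists (- (\sum_i' c i' * z (i, i'))); rewrite aE expnS natrM -mulrA.
  congr (_ * _); rewrite mulrN mulr_sumr; congr (- _); apply: eq_bigr => i' _.
  by rewrite mulrA -cE.
by move=> i; have [c ->] := a_div s i; rewrite ps0 mul0r.
Qed.
End Residue.

(** * Duals of the reduced monomials over F *)

Lemma vandermonde_dual (F : finFieldType) :
  exists w : 'I_#|F| -> F -> F,
    forall j k : 'I_#|F|, \sum_y w j y * y ^+ k = (j == k)%:R.
Proof.
pose V := Vandermonde #|F| (\row_(i < #|F|) enum_val i : 'rV[F]_#|F|).
have VU : V \in unitmx.
  rewrite unitmxE unitfE det_Vandermonde; apply/prodf_neq0 => i _.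
  apply/prodf_neq0 => j ij; rewrite !mxE subr_eq0.
  by rewrite (inj_eq enum_val_inj) neq_ltn ij orbT.
(* [w j] is column j of the inverse Vandermonde matrix, its rows being indexed by the points of
   F. *)
exists (fun j y => invmx V (enum_rank y) j) => j k.
rewrite (reindex (@enum_val F F)) /=; last first.
  by apply: onW_bij; exists enum_rank; [apply: enum_valK | apply: enum_rankK].
have /matrixP/(_ k j) := mulmxV VU.
rewrite !mxE eq_sym => <-; apply: eq_bigr => i _.
by rewrite !mxE enum_valK mulrC.
Qed.

(** Products of one-variable duals work: the sum over F^m factors into one Kronecker delta per
    coordinate. *)
Lemma monomial_dual (F : finFieldType) (m : nat) :
  exists W : {ffun 'I_m -> 'I_#|F|} -> {ffun 'I_m -> F} -> F,
    forall mu nu : {ffun 'I_m -> 'I_#|F|},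
      \sum_x W mu x * \prod_i x i ^+ nu i = (mu == nu)%:R.
Proof.
have [w wE] := vandermonde_dual F.
exists (fun mu x => \prod_i w (mu i) (x i)) => mu nu.
under eq_bigr do rewrite -big_split /=.
rewrite -(bigA_distr_bigA (fun i y => w (mu i) y * y ^+ nu i)) /=.
under eq_bigr do rewrite wE.
case: eqP => [->|/eqP mu_nu]; first by rewrite big1 // => i _; rewrite eqxx.
have [i mu_nu_i] : exists i, mu i != nu i.
  apply/existsP; apply: contraR mu_nu => /existsPn /= eq_mu_nu.
  by apply/eqP/ffunP => i; apply/eqP/negbNE/eq_mu_nu.
by rewrite (bigD1 i) //= (negPf mu_nu_i) mul0r.
Qed.

(** * Freeness and rank of the code *)

Lemma RM_free (p s : nat) (L : finComNzRingType) (F : finFieldType)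
    (red : {rmorphism L -> F}) (m nu : nat) (b : nat -> 'rV[L]_m) :
  residue_map p red -> (p ^ s)%:R = 0 :> L ->
  (forall x : {ffun 'I_m -> F}, exists k : 'I_(#|F| ^ m),
     forall j, red (eval_point b k 0 j) = x j) ->
  free_of_rank (@RM L #|F| m b nu)
    #|[set f : {ffun 'I_m -> 'I_#|F|} | (\sum_j f j <= nu)%N]|.
Proof.
move=> redP ps0 pts; set S := [set f | _].
have [K KE] := fin_all_exists pts.
pose mon (i : 'I_#|S|) : 'X_{1..m} := [multinom enum_val i j : nat | j < m].
have mon_inj : injective mon.
  move=> i i' /mnmP E; apply: enum_val_inj; apply/ffunP => j; apply: val_inj.
  by have := E j; rewrite !mnmE.
have monP (mu : 'X_{1..m}) : (forall j, mu j <= #|F|.-1)%N ->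
    (mdeg mu <= nu)%N -> exists i, mon i = mu.
  move=> muF munu; have F0 : (0 < #|F|)%N by apply/card_gt0P; exists 0.
  have muF' j : (mu j < #|F|)%N by rewrite -(prednK F0) ltnS.
  pose f : {ffun 'I_m -> 'I_#|F|} := [ffun j => Ordinal (muF' j)].
  have fS : f \in S.
    rewrite inE (leq_trans _ munu) // mdegE leq_sum // => j _.
    by rewrite ffunE.
  exists (enum_rank_in fS f); apply/mnmP => j.
  by rewrite mnmE enum_rankK_in // ffunE.
have mon_le i j : (mon i j <= #|F|.-1)%N.
  by rewrite mnmE -ltnS (leq_trans (ltn_ord _)) ?leqSpred.
have mon_deg i : (mdeg (mon i) <= nu)%N.
  have := enum_valP i; rewrite inE mdegE; congr (_ <= _)%N.
  by apply: eq_bigr => j _; rewrite mnmE.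
exists (fun i => ev #|F| b 'X_[mon i]); split.
  have evE a : \sum_i a i *: ev #|F| b 'X_[mon i] =
      ev #|F| b (\sum_i a i *: 'X_[mon i]).
    apply/rowP => k; rewrite summxE mxE raddf_sum /=; apply: eq_bigr => i _.
    by rewrite !mxE mevalZ.
  move=> v; split=> [[P [Pmu Pnu ->]]|[a ->]].
    exists (fun i => P@_(mon i)); rewrite evE; congr ev; apply/mpolyP => mu.
    rewrite raddf_sum /=.
    have [/existsP[i /eqP <-]|/existsPn no_mu] := boolP [exists i, mon i == mu].
      rewrite (bigD1 i) //= mcoeffZ mcoeffX eqxx mulr1 big1 ?addr0 // => i' ii'.
      by rewrite mcoeffZ mcoeffX (inj_eq mon_inj) (negPf ii') mulr0.
    rewrite big1 => [|i _]; last first.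
      by rewrite mcoeffZ mcoeffX (negPf (no_mu i)) mulr0.
    (* The degree bounds on [P] put every monomial of its support among the [mon i]. *)
    apply/eqP; rewrite mcoeff_eq0; apply/negP => muP.
    have [i E] : exists i, mon i = mu.
      apply: monP => [j|]; first exact: Pmu.
      by rewrite -ltnS (leq_trans _ Pnu) // msize_mdeg_lt.
    by have := no_mu i; rewrite E eqxx.
  have msuppE mu : mu \in msupp (\sum_i a i *: 'X_[mon i]) ->
      exists i, mon i = mu.
    rewrite mcoeff_msupp raddf_sum /= => nz.
    suff /existsP[i /eqP <-] : [exists i, mon i == mu] by exists i.
    apply: contraNT nz => /existsPn no_mu; rewrite big1 // => i _.
    by rewrite mcoeffZ mcoeffX (negPf (no_mu i)) mulr0.
  exists (\sum_i a i *: 'X_[mon i]); split; last exact: evE.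
    by move=> j mu /msuppE[i <-].
  by rewrite msizeE; apply/bigmax_leqP_seq => mu /msuppE[i <-] _; rewrite ltnS.
have [W WE] := monomial_dual F m.
(* Independence is tested at one chosen evaluation point [K x] above each [x] in F^m, where the
   reduced matrix has the left inverse [W]. *)
move=> a aE; pose M (x : {ffun 'I_m -> F}) i := ev #|F| b 'X_[mon i] 0 (K x).
apply: (residue_lift_free redP ps0 (M := M) (W := fun i => W (enum_val i))).
  move=> i i'; rewrite -(inj_eq enum_val_inj) -WE; apply: eq_bigr => x _.
  rewrite /M mxE mevalX rmorph_prod; congr (_ * _); apply: eq_bigr => j _.
  by rewrite rmorphXn /= KE mnmE.
move=> x; have /rowP/(_ (K x)) := aE; rewrite summxE mxE => E.
by rewrite -[RHS]E; apply: eq_bigr => i _; rewrite mxE.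
Qed.

Theorem theorem5p2 (p s r m nu : nat) (L : finComNzRingType)
    (F : finFieldType) (red : {rmorphism L -> F})
    (h : {poly L}) (xi : {poly %/ h}) (b : nat -> 'rV[L]_m) :
  let q := (p ^ r)%N in
  let n := (q ^ m - 1)%N in
  prime p -> (1 <= s)%N -> (1 <= r)%N -> (1 <= m)%N -> (s <= r * m)%N ->
  galois_ring p s r L ->
  residue_map p red ->
  basic_primitive red m h ->
  (exists g : {poly L}, 'X^n - 1 = g * h) ->
  root (map_poly (in_alg {poly %/ h}) h) xi ->
  n.-primitive_root xi ->
  (forall i : nat, (i < n)%N ->
     xi ^+ i = \sum_(j < m) b i 0 j *: xi ^+ j) ->
  (nu <= m * (q - 1))%N ->
  exists k : nat, k%:Z = RM_rank q m nu /\ free_of_rank (@RM L q m b nu) k.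
Proof.
move=> q n p_pr s0 r0 m0 _ [[ps0 _] cardL _ _] redP hP _ hxi xin bE _.
have q1 : (1 < q)%N by rewrite -(exp1n r) ltn_exp2r // prime_gt1.
have qm1 : (1 < q ^ m)%N by rewrite -(exp1n m) ltn_exp2r.
have n1 : n.+1 = (q ^ m)%N by rewrite /n subn1 prednK // ltnW.
have n0 : (0 < n)%N by rewrite -ltnS n1.
have [Fn inj] := root_qpoly_powers_inj m0 n0 hP hxi (prim_expr_order xin) bE.
(* The order of [xi] gives |F|^m <= q^m, and counting digits gives q^s = |L| <= |F|^s. *)
have Fq : #|F| = q.
  apply/eqP; rewrite eqn_leq; apply/andP; split.
    by rewrite -(leq_exp2r _ _ m0) -n1.
  rewrite -(leq_exp2r _ _ s0) -expnM mulnC -cardL.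
  exact: card_residue_le redP ps0.
exists #|[set f : {ffun 'I_m -> 'I_#|F|} | (\sum_j f j <= nu)%N]|.
split; first by rewrite RM_rankE ?Fq.
rewrite -Fq; apply: RM_free redP ps0 _ => x.
pose pt (k : 'I_(#|F| ^ m)) := [ffun j => red (eval_point b k 0 j)].
have pt_inj : injective pt.
  move=> k k' E; apply/val_inj/inj; rewrite ?inE ?n1 -?Fq ?ltn_ord //.
  by apply/rowP => j; move/ffunP/(_ j): E; rewrite !ffunE !mxE.
(* An injection between sets of the same size |F|^m is onto. *)
have /codomP[k ->] : x \in codom pt.
  by apply: inj_card_onto => //; rewrite card_ffun !card_ord.
by exists k => j; rewrite ffunE.
Qed.
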